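(* Let $d\ge2$. For every $p>0$ and every even integer $q>p$, every Borel probability measure on $\mathbb S^{d-1}$ minimizing the energy $\iint L_{p,q}(x,y)\,d\mu(x)\,d\mu(y)$ (over all Borel probability measures $\mu$ on $\mathbb S^{d-1}$) of the continuous kernel $$L_{p,q}(x,y)=|x\cdot y|^p-\frac pq|x\cdot y|^q$$ has finite support. Moreover, $\|L_{p,q}-K_p\|_\infty=p/q$, where $K_p(x,y)=|x\cdot y|^p$.
   Context: $\mathbb S^{d-1}$ is the real unit sphere in $\mathbb R^d$, and $\|\cdot\|_\infty$ denotes the supremum norm on $\mathbb S^{d-1}\times\mathbb S^{d-1}$. *)

(* Defs.v *)
From HB Require Import structures.
From mathcomp Require Import all_boot all_order all_algebra.
From mathcomp Require Import all_classical all_reals all_analysis.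

Set Implicit Arguments.
Unset Strict Implicit.
Unset Printing Implicit Defensive.

Import Order.TTheory GRing.Theory Num.Theory numFieldNormedType.Exports.
Local Open Scope classical_set_scope.
Local Open Scope ring_scope.

Definition dotp (R : realType) (d : nat) (x y : 'rV[R]_d) : R :=
  \sum_(i < d) x ord0 i * y ord0 i.

(* The library norm `|x| on 'rV[R]_d is the max norm, hence this definition. *)
Definition enorm (R : realType) (d : nat) (x : 'rV[R]_d) : R :=
  Num.sqrt (dotp x x).

Definition unit_sphere (R : realType) (d : nat) : set 'rV[R]_d :=
  [set x | enorm x = 1].

Lemma unit_sphere_delta (R : realType) (d : nat) (hd : (2 <= d)%N) :
  delta_mx ord0 (Ordinal (ltnW hd)) \in @unit_sphere R d.
Proof.
rewrite inE /unit_sphere /= /enorm /dotp (bigD1 (Ordinal (ltnW hd))) //= big1.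
  by rewrite addr0 !mxE !eqxx mulr1 sqrtr1.
by move=> i /negbTE ni; rewrite !mxE ni andbF mulr0.
Qed.

(* The sphere as a type. The proof hd is an index only because measurable
   types must be inhabited, and the sphere of R^0 is empty. *)
Definition sphere (R : realType) (d : nat) (hd : (2 <= d)%N) : Type :=
  set_type (@unit_sphere R d).

HB.instance Definition _ (R : realType) (d : nat) (hd : (2 <= d)%N) :=
  Topological.copy (sphere R hd) (set_type (@unit_sphere R d)).
HB.instance Definition _ (R : realType) (d : nat) (hd : (2 <= d)%N) :=
  isPointed.Build (sphere R hd)
    (exist _ (delta_mx ord0 (Ordinal (ltnW hd))) (unit_sphere_delta R hd)).

Definition borel_sphere (R : realType) (d : nat) (hd : (2 <= d)%N) :=
  g_sigma_algebraType (@open (sphere R hd)).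

Definition sdot (R : realType) (d : nat) (hd : (2 <= d)%N)
  (x y : sphere R hd) : R := dotp (\val x) (\val y).

Definition K (R : realType) (d : nat) (hd : (2 <= d)%N) (p : R)
  (x y : sphere R hd) : R := `|sdot x y| `^ p.

Definition L (R : realType) (d : nat) (hd : (2 <= d)%N) (p : R) (q : nat)
  (x y : sphere R hd) : R :=
  `|sdot x y| `^ p - p / q%:R * `|sdot x y| ^+ q.

Definition energy (R : realType) (d : nat) (hd : (2 <= d)%N)
  (F : sphere R hd -> sphere R hd -> R)
  (mu : probability (borel_sphere R hd) R) : \bar R :=
  (\int[mu]_x \int[mu]_y (F x y)%:E)%E.

Definition minimizes_energy (R : realType) (d : nat) (hd : (2 <= d)%N)
  (F : sphere R hd -> sphere R hd -> R)
  (mu : probability (borel_sphere R hd) R) : Prop :=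
  forall nu : probability (borel_sphere R hd) R,
    (energy F mu <= energy F nu)%E.

Definition msupport (R : realType) (d : nat) (hd : (2 <= d)%N)
  (mu : probability (borel_sphere R hd) R) : set (sphere R hd) :=
  [set x | forall U : set (sphere R hd), open U -> U x -> (0 < mu U)%E].

(* Extended-real valued, so that it is +oo on unbounded functions. *)
Definition supnorm (R : realType) (d : nat) (hd : (2 <= d)%N)
  (F : sphere R hd -> sphere R hd -> R) : \bar R :=
  ereal_sup (range (fun z : sphere R hd * sphere R hd => `|F z.1 z.2|%:E)).

(* Main.v *)
(** If [mu] is a minimizer, perturbing [mu] by densities of mean zero shows that
    [L] is positive semidefinite on the mean-zero signed measures carried by
    finitely many points of the support. For three points, with
    [D = L(x, x) - L], this says that [sqrt D] satisfies the triangle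
    inequality. Suppose that the support has a limit point [x], and let [u] be a
    cluster point of the directions from [x] to support points [y] tending to
    [x]. The profile [t^p - (p/q) t^q] has slope zero at [t = 1], so
    [D(x, y) = o(|x - y|^2)], and positive slope on (0, 1); for a support point
    [z] near [x], the triangle inequality for [x], [y], [z] thus gives
    [z . u <= 0]. Since [x . u = 0], every direction from [x] to a nearby support
    point has nonpositive product with [u], and so does their cluster point [u],
    although [u] is a unit vector. Hence the support has no limit point, and it
    is finite because the sphere is compact. *)

Require Import Defs.
From mathcomp Require Import all_boot all_order all_algebra.
From mathcomp Require Import all_classical all_reals all_analysis.
From mathcomp Require Import measurable_realfun ring lra.

Set Implicit Arguments.
Unset Strict Implicit.
Unset Printing Implicit Defensive.

Import Order.TTheory GRing.Theory Num.Theory numFieldNormedType.Exports.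
Local Open Scope classical_set_scope.
Local Open Scope ring_scope.

(** * Second variation of the energy *)

Section bounded_integral.
Context d (T : measurableType d) (R : realType).
Implicit Types (m : {finite_measure set T -> \bar R}) (f : T -> R) (M : R).

Lemma bounded_integrable m f M : measurable_fun setT f ->
  (forall x, 0 <= f x <= M) -> m.-integrable setT (EFin \o f).
Proof.
move=> mf fM; apply: measurable_bounded_integrable => //.
  by rewrite -ge0_fin_numE// fin_num_measure.
exists M; split; first exact: num_real.
move=> N MN x _ /=; case/andP: (fM x) => f0 fxM.
by rewrite ger0_norm// (le_trans fxM)// ltW.
Qed.

Lemma bounded_EFin_Rintegral m f M : measurable_fun setT f ->
  (forall x, 0 <= f x <= M) ->
  (\int[m]_x (f x)%:E)%E = (\int[m]_x f x)%:E.
Proof.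
move=> mf fM; rewrite fineK//; apply: integrable_fin_num => //.
exact: (@bounded_integrable _ _ M).
Qed.

Lemma bounded_Rintegral_le m f M : measurable_fun setT f ->
  (forall x, 0 <= f x <= M) ->
  0 <= \int[m]_x f x <= M * fine (m setT).
Proof.
move=> mf fM; apply/andP; split.
  by apply: Rintegral_ge0 => x _; case/andP: (fM x).
rewrite -Rintegral_cst//; apply: le_Rintegral => //.
- exact: (@bounded_integrable _ _ M).
- apply: (@bounded_integrable _ _ M) => // x; rewrite lexx andbT.
  by case/andP: (fM x); exact: le_trans.
- by move=> x _; case/andP: (fM x).
Qed.

Lemma Rintegral_measure_add (mu m r : {finite_measure set T -> \bar R}) f M :
  (forall A, measurable A -> mu A = m A + r A)%E ->
  measurable_fun setT f -> (forall x, 0 <= f x <= M) ->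
  \int[mu]_x f x = \int[m]_x f x + \int[r]_x f x.
Proof.
move=> mumr mf fM; apply: EFin_inj; rewrite EFinD.
rewrite -!(@bounded_EFin_Rintegral _ _ M)//.
rewrite (@eq_measure_integral _ _ _ _ (measure_add m r)) => [|A mA _].
  rewrite ge0_integral_measure_add//.
    by move=> x _; rewrite lee_fin; case/andP: (fM x).
  exact/measurable_EFinP.
exact: etrans (mumr _ mA) (esym (measure_addE m r A)).
Qed.

End bounded_integral.

(** * Perturbing a probability measure *)

Section perturbation.
Context d (T : measurableType d) (R : realType) (mu : probability T R).
Variables (n : nat) (m r : nat -> {finite_measure set T -> \bar R}).
Hypothesis mumr : forall i A, measurable A -> (mu A = m i A + r i A)%E.

(* [mu + \sum_i b_i m_i] is written as [\sum_i ((1/n + b_i) m_i + r_i / n)],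
   in which all coefficients are nonnegative. *)
Lemma perturbed_probability (b : nat -> R) :
  (forall i, (i < n.+1)%N -> 0 <= n.+1%:R^-1 + b i) ->
  \sum_(i < n.+1) b i * fine (m i setT) = 0 ->
  exists nu : probability T R, forall (f : T -> R) (M : R),
    measurable_fun setT f -> (forall x, 0 <= f x <= M) ->
    (\int[nu]_x (f x)%:E)%E =
    (\int[mu]_x f x + \sum_(i < n.+1) b i * \int[m i]_x f x)%:E.
Proof.
move=> b_ge b0.
(* The absolute values only package nonnegativity: both coefficients are already nonnegative, the
   first one by [b_ge]. *)
pose w i : {measure set T -> \bar R} :=
  measure_add (mscale (NngNum (normr_ge0 (n.+1%:R^-1 + b i))) (m i))
              (mscale (NngNum (normr_ge0 (n.+1%:R^-1 : R))) (r i)).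
pose nu0 : {measure set T -> \bar R} := msum w n.+1.
have nu0E (f : T -> R) (M : R) : measurable_fun setT f ->
    (forall x, 0 <= f x <= M) ->
    (\int[nu0]_x (f x)%:E)%E =
    (\int[mu]_x f x + \sum_(i < n.+1) b i * \int[m i]_x f x)%:E.
  move=> mf fM.
  have f0 x : setT x -> (0 <= (f x)%:E)%E by rewrite lee_fin; case/andP: (fM x).
  have mEf : measurable_fun setT (EFin \o f) by exact/measurable_EFinP.
  rewrite /nu0 ge0_integral_measure_sum//.
  have -> : \int[mu]_x f x = \sum_(i < n.+1) n.+1%:R^-1 * \int[mu]_x f x.
    by rewrite sumr_const card_ord -mulrnAl -mulr_natr mulVf ?mul1r.
  rewrite -big_split/= -sumEFin; apply: eq_bigr => i _.
  rewrite ge0_integral_measure_add// !ge0_integral_mscale//=.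
  rewrite !(@bounded_EFin_Rintegral _ _ _ _ _ M)// -!EFinM -EFinD.
  rewrite (ger0_norm (b_ge _ _))// ger0_norm//.
  rewrite (@Rintegral_measure_add _ _ _ mu (m i) (r i) _ M)//; last exact: mumr.
  by congr EFin; ring.
(* The total mass is the integral of the constant 1, in which the perturbation contributes 0 by
   [b0]. *)
have nu1 : nu0 setT = 1%E.
  have fM1 (x : T) : 0 <= (cst 1 x : R) <= 1 by rewrite ler01 lexx.
  rewrite -[LHS]mul1e -integral_cst// (nu0E _ _ (measurable_cst _) fM1).
  have I1 (k : {measure set T -> \bar R}) : \int[k]_x cst 1 x = fine (k setT).
    by rewrite Rintegral_cst// mul1r.
  rewrite I1 (_ : fine _ = 1); last exact: congr1 (probability_setT mu).
  rewrite -[RHS]addr0; congr (_ + _)%:E; rewrite -[RHS]b0.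
  by apply: eq_bigr => i _; rewrite I1.
(* Normalizing divides by 1, so the measure is unchanged; it merely acquires the structure of a
   [probability]. *)
have nuE A : mnormalize nu0 mu A = nu0 A.
  rewrite /mnormalize (_ : nu0 setT = 1%E)// onee_eq0/=.
  by rewrite invr1 mule1.
exists (mnormalize nu0 mu) => f M mf fM; rewrite -(nu0E f M)//.
by apply: eq_measure_integral => A mA _; exact: nuE.
Qed.

End perturbation.

(** * Expansion of the energy to second order *)

Section second_variation.
Context d (T : measurableType d) (R : realType).
Variables (F : T -> T -> R) (M : R).
Hypothesis mF : measurable_fun setT (fun z : T * T => F z.1 z.2).
Hypothesis FM : forall x y, 0 <= F x y <= M.

Local Notation potential k x := (\int[k]_y F x y).

Lemma measurable_section x : measurable_fun setT (F x).
Proof. exact: (measurableT_comp mF (pair1_measurable x)). Qed.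

Lemma measurable_potential (k : {finite_measure set T -> \bar R}) :
  measurable_fun setT (fun x => potential k x).
Proof.
apply/measurable_EFinP.
have mEF : measurable_fun setT (fun z : T * T => (F z.1 z.2)%:E).
  exact/measurable_EFinP.
have F0 z : (0 <= (F z.1 z.2)%:E)%E by rewrite lee_fin; case/andP: (FM z.1 z.2).
have := measurable_fun_fubini_tonelli_F (m2 := k) _ mEF F0.
apply: eq_measurable_fun => x _.
rewrite /fubini_F /= (@bounded_EFin_Rintegral _ _ _ k _ M)//.
exact: measurable_section.
Qed.

Lemma potential_bounds (k : {finite_measure set T -> \bar R}) x :
  0 <= potential k x <= M * fine (k setT).
Proof. exact: bounded_Rintegral_le (measurable_section x) (FM x). Qed.

Lemma integrable_potential (k l : {finite_measure set T -> \bar R}) :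
  k.-integrable setT (EFin \o (fun x => potential l x)).
Proof.
exact: bounded_integrable (measurable_potential l) (potential_bounds l).
Qed.

Lemma Rintegral_potential_sum (k l : {finite_measure set T -> \bar R})
    (m : nat -> {finite_measure set T -> \bar R}) (c : nat -> R) N :
  \int[k]_x (potential l x + \sum_(i < N) c i * potential (m i) x) =
  \int[k]_x potential l x + \sum_(i < N) c i * \int[k]_x potential (m i) x.
Proof.
have intZ i : k.-integrable setT (EFin \o (fun x => c i * potential (m i) x)).
  rewrite (_ : _ \o _ = fun x => ((c i)%:E * (potential (m i) x)%:E)%E)//.
  by apply: integrableZl => //; exact: integrable_potential.
have intS N' : k.-integrable setT
    (EFin \o (fun x => \sum_(i < N') c i * potential (m i) x)).
  rewrite (_ : _ \o _ = fun x => (\sum_(i < N') (c i * potential (m i) x)%:E)%E).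
    by apply: integrable_sum => // i _; exact: intZ.
  by apply/funext => x /=; rewrite sumEFin.
rewrite RintegralD//; last exact: integrable_potential.
congr (_ + _); elim: N => [|N IHN].
  under eq_Rintegral do rewrite big_ord0.
  by rewrite big_ord0 Rintegral_cst// mul0r.
under eq_Rintegral do rewrite big_ord_recr/=.
rewrite (RintegralD measurableT (intS N) (intZ N)) IHN big_ord_recr/= RintegralZl//.
exact: integrable_potential.
Qed.

Variables (mu : probability T R) (n : nat).
Variables (m r : nat -> {finite_measure set T -> \bar R}).
Hypothesis mumr : forall i A, measurable A -> (mu A = m i A + r i A)%E.

(** The energy is quadratic in the measure, here [mu] plus the sum of the [c i] times [m i].
    Symmetry of [F] is not assumed, so the linear term contains both mixed integrals. *)
Lemma perturbed_energy (c : nat -> R) :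
  (forall i, (i < n.+1)%N -> 0 <= n.+1%:R^-1 + c i) ->
  \sum_(i < n.+1) c i * fine (m i setT) = 0 ->
  exists nu : probability T R,
    (\int[nu]_x \int[nu]_y (F x y)%:E)%E =
    (\int[mu]_x potential mu x + \sum_(i < n.+1) c i *
      (\int[mu]_x potential (m i) x + \int[m i]_x potential mu x) +
     \sum_(i < n.+1) \sum_(j < n.+1) c i * c j *
      \int[m i]_x potential (m j) x)%:E.
Proof.
move=> cge c0.
have [nu nuE] := perturbed_probability mumr cge c0; exists nu.
have nuFE x := nuE _ _ (measurable_section x) (FM x).
under eq_integral do rewrite nuFE.
have potE x : potential mu x + \sum_(i < n.+1) c i * potential (m i) x =
    potential nu x.
  by rewrite /Rintegral nuFE.
rewrite (nuE _ (M * fine (nu setT))); last 2 first.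
- by under eq_fun do rewrite potE; exact: measurable_potential.
- by move=> x; rewrite potE; exact: potential_bounds.
congr EFin; rewrite (Rintegral_potential_sum mu mu) -!addrA; congr (_ + _).
rewrite -!big_split; apply: eq_bigr => i _ /=.
rewrite (Rintegral_potential_sum (m i) mu) !mulrDr -!addrA; congr (_ + (_ + _)).
by rewrite mulr_sumr; apply: eq_bigr => j _; rewrite mulrA.
Qed.

(** Perturbing by [t * b] and by [- t * b] gives two competitors. In the sum of their energies the
    linear terms cancel, so minimality leaves [t ^+ 2] times the quadratic form. *)
Lemma second_variation_ge0 (b : nat -> R) :
  (forall nu : probability T R,
    (\int[mu]_x \int[mu]_y (F x y)%:E <= \int[nu]_x \int[nu]_y (F x y)%:E)%E) ->
  \sum_(i < n.+1) b i * fine (m i setT) = 0 ->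
  0 <= \sum_(i < n.+1) \sum_(j < n.+1) b i * b j *
         \int[m i]_x potential (m j) x.
Proof.
move=> mu_min b0.
(* This scale makes every [t * b i] at most [n.+1%:R^-1] in absolute value, so that both
   perturbations are admissible; the added 1 keeps [s] positive. *)
pose s := 1 + \sum_(i < n.+1) `|b i|; pose t := n.+1%:R^-1 / s.
have s0 : 0 < s by rewrite ltr_pwDl// sumr_ge0.
have t0 : 0 < t by rewrite divr_gt0// invr_gt0.
have tb i : (i < n.+1)%N -> `|t * b i| <= n.+1%:R^-1.
  move=> ni; rewrite normrM (gtr0_norm t0) mulrAC ler_pdivrMr//.
  rewrite ler_wpM2l// /s (bigD1 (Ordinal ni))//= addrCA lerDl addr_ge0//.
  exact: sumr_ge0.
clearbody t; have energyE (e : R) : `|e| = 1 -> exists nu : probability T R,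
    (\int[nu]_x \int[nu]_y (F x y)%:E)%E =
    (\int[mu]_x potential mu x + e * t * (\sum_(i < n.+1) b i *
      (\int[mu]_x potential (m i) x + \int[m i]_x potential mu x)) +
     t ^+ 2 * \sum_(i < n.+1) \sum_(j < n.+1) b i * b j *
      \int[m i]_x potential (m j) x)%:E.
  move=> e1; have e2 : e ^+ 2 = 1 by rewrite -real_normK ?num_real// e1 expr1n.
  have [||nu nuE] := @perturbed_energy (fun i => e * t * b i).
  - move=> i ni; rewrite -lerBlDl sub0r; have := tb _ ni.
    by rewrite -[`|_|]mul1r -e1 -normrM mulrA ler_norml => /andP[].
  - by under eq_bigr do rewrite -mulrA; rewrite -mulr_sumr b0 mulr0.
  exists nu; rewrite nuE; congr (_ + _ + _)%:E; rewrite mulr_sumr; apply: eq_bigr => i _.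
    by rewrite mulrA.
  rewrite mulr_sumr; apply: eq_bigr => j _; rewrite !mulrA; congr (_ * _).
  by ring: e2.
have muE : (\int[mu]_x \int[mu]_y (F x y)%:E)%E = (\int[mu]_x potential mu x)%:E.
  under eq_integral do rewrite (bounded_EFin_Rintegral mu (measurable_section _) (FM _)).
  exact: bounded_EFin_Rintegral (measurable_potential mu) (potential_bounds mu).
have [nu1 E1] := energyE 1 (normr1 _).
have [nu2 E2] := energyE (-1) (normrN1 _).
have := mu_min nu1; have := mu_min nu2; rewrite muE E1 E2 !lee_fin.
set A := \int[mu]_x _; set C := \sum_(i < _) _; set B := \sum_(i < _) _.
move=> h1 h2; have : 0 <= t ^+ 2 * C by lra.
by rewrite pmulr_rge0// exprn_gt0.
Qed.

End second_variation.

(** * From the second variation to points of the support *)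

(** The restricted measure ignores the values of [f] off [U], and on [U] the function lies between
    [c - e] and [c + e]. Two nested uses compare a double integral over small sets with the value of
    the kernel at a pair of points. *)
Lemma Rintegral_restr_approx d (T : measurableType d) (R : realType)
    (mu : {finite_measure set T -> \bar R}) (U : set T) (mU : measurable U)
    (f : T -> R) (M c e : R) :
  measurable_fun setT f -> (forall x, 0 <= f x <= M) ->
  (forall x, U x -> `|f x - c| <= e) ->
  `|\int[mrestr mu mU]_x f x - c * fine (mu U)| <= e * fine (mu U).
Proof.
move=> mf fM fce; set k := mrestr mu mU.
have kU : fine (k U) = fine (mu U) by rewrite /k /mrestr setIid.
have intf := bounded_integrable k mf fM.
have -> : \int[k]_x f x = \int[k]_(x in U) f x.
  congr fine; rewrite (@negligible_integral _ _ _ _ setT (~` U))//.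
  - by rewrite setTD setCK.
  - exact: measurableC.
  - by rewrite /k /= /mrestr setICl measure0.
have intfU : k.-integrable U (EFin \o f) by exact: integrableS intf.
have intc (y : R) : k.-integrable U (EFin \o cst y).
  exact: finite_measure_integrable_cst.
have lo : \int[k]_(x in U) (c - e) <= \int[k]_(x in U) f x.
  apply: le_Rintegral => // [|x Ux]; first exact: intc.
  by have := fce x Ux; rewrite ler_norml; lra.
have hi : \int[k]_(x in U) f x <= \int[k]_(x in U) (c + e).
  apply: le_Rintegral => // [|x Ux]; first exact: intc.
  by have := fce x Ux; rewrite ler_norml; lra.
move: lo hi; rewrite !Rintegral_cst// kU ler_norml.
move: (\int[_]_(_ in _) _) (fine _) => I p; clear => lo hi.
by apply/andP; split; lra.
Qed.

Section support.
Context (R : realType) (d : nat) (hd : (2 <= d)%N).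
Variables (F : sphere R hd -> sphere R hd -> R) (M : R).
Hypothesis cF : continuous (fun z : sphere R hd * sphere R hd => F z.1 z.2).
Hypothesis mF : measurable_fun setT
  (fun z : borel_sphere R hd * borel_sphere R hd => F z.1 z.2).
Hypothesis FM : forall x y, 0 <= F x y <= M.
Variable mu : probability (borel_sphere R hd) R.
Hypothesis mu_min : minimizes_energy F mu.

(** Continuity at each pair [(x i, x j)] gives a product neighborhood; [U i] is the interior of the
    intersection of the finitely many factors at [x i]. *)
Lemma common_neighborhoods (n : nat) (x : 'I_n.+1 -> sphere R hd) (e : R) :
  0 < e -> exists U : 'I_n.+1 -> set (sphere R hd),
    [/\ forall i, open (U i), forall i, U i (x i) &
        forall i j u v, U i u -> U j v -> `|F u v - F (x i) (x j)| <= e].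
Proof.
move=> e0.
have H (ij : 'I_n.+1 * 'I_n.+1) : exists AB : set (sphere R hd) * set (sphere R hd),
    [/\ nbhs (x ij.1) AB.1, nbhs (x ij.2) AB.2 &
      forall u v, AB.1 u -> AB.2 v -> `|F u v - F (x ij.1) (x ij.2)| <= e].
  have /cvgrPdist_le /(_ _ e0) := @cF (x ij.1, x ij.2).
  move=> [[A B] /= [nA nB] AB]; exists (A, B); split => // u v Au Bv.
  by rewrite distrC; exact: (AB (u, v)).
have [AB HAB] := choice H.
pose U i := interior [set u | forall j, (AB (i, j)).1 u /\ (AB (j, i)).2 u].
exists U; split=> [i|i|i j u v /interior_subset Uu /interior_subset Uv].
- exact: open_interior.
- have ABx j : nbhs (x i) [set u | (AB (i, j)).1 u /\ (AB (j, i)).2 u].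
    by apply: filterI; [have [] := HAB (i, j)|have [] := HAB (j, i)].
  exact: (@filter_forall _ _ _ _ _ ABx).
- by have [_ _] := HAB (i, j); apply; [case: (Uu j)|case: (Uv i)].
Qed.

(** Each weight [a i] is spread evenly over a small neighborhood [U i] of [x i], which has positive
    mass because [x i] is in the support. The second variation then gives the form with averaged
    entries, and each average is within [e] of [F (x i) (x j)]. *)
Lemma support_positive_semidefinite (n : nat) (x : 'I_n.+1 -> sphere R hd)
    (a : 'I_n.+1 -> R) :
  (forall i, msupport mu (x i)) -> \sum_i a i = 0 ->
  0 <= \sum_i \sum_j a i * a j * F (x i) (x j).
Proof.
move=> xS a0; pose c := \sum_i \sum_j `|a i * a j|.
have c0 : 0 <= c by apply: sumr_ge0 => i _; exact: sumr_ge0.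
(* The total error is at most [e * c], hence below [e']; the added 1 covers the case [c = 0]. *)
apply/ler_addgt0Pr => e' e'0; pose e := e' / (c + 1).
have c10 : 0 < c + 1 by rewrite ltr_wpDl.
have e0 : 0 < e by rewrite divr_gt0.
apply: (@le_trans _ _ (\sum_i \sum_j a i * a j * F (x i) (x j) + e * c)); last first.
  rewrite lerD2l /e mulrAC ler_pdivrMr// ler_wpM2l// ?ltW//.
  by rewrite ltrDl.
have [U [oU Ux UF]] := common_neighborhoods x e0.
have mU i : measurable (U i : set (borel_sphere R hd)).
  exact: sub_sigma_algebra (oU i).
pose p i := fine (mu (U i)).
have p0 i : 0 < p i.
  by rewrite fine_gt0// (xS i _ (oU i) (Ux i)) -ge0_fin_numE// fin_num_measure.
pose m (i : nat) : {finite_measure set (borel_sphere R hd) -> \bar R} :=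
  mrestr mu (mU (inord i)).
pose r (i : nat) : {finite_measure set (borel_sphere R hd) -> \bar R} :=
  mrestr mu (measurableC (mU (inord i))).
pose b (i : nat) := a (inord i) / p (inord i).
have mumr i A : measurable A -> (mu A = m i A + r i A)%E.
  move=> mA; rewrite /m /r /= /mrestr addeC -setDE.
  by apply: measureDI.
have mT i : fine (m i setT) = p (inord i) by rewrite /m /= /mrestr setTI.
have := @second_variation_ge0 _ (borel_sphere R hd) R F M mF FM mu n m r mumr b mu_min.
rewrite (eq_bigr a) => [/(_ a0)|i _]; last first.
  by rewrite mT /b inord_val divfK// gt_eqF.
move=> h; apply: (le_trans h).
rewrite mulr_sumr -big_split/=; apply: ler_sum => i _.
rewrite mulr_sumr -big_split/=; apply: ler_sum => j _.
(* The approximation is applied to the outer integral with center [F (x i) (x j) * p j] and error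
   [e * p j], which come from applying it to the inner one. *)
have JF : `|\int[m i]_u \int[m j]_v F u v - F (x i) (x j) * p j * p i| <= e * p j * p i.
  rewrite /m !inord_val.
  pose mj : {finite_measure set (borel_sphere R hd) -> \bar R} := mrestr mu (mU j).
  apply: (@Rintegral_restr_approx _ _ _ _ _ _ _ (M * fine (mj setT))).
  - exact: (@measurable_potential _ (borel_sphere R hd) _ F M mF FM mj).
  - exact: (@potential_bounds _ (borel_sphere R hd) _ F M mF FM mj).
  - move=> u Uu; apply: (@Rintegral_restr_approx _ _ _ _ _ _ _ M) => //.
      exact: (@measurable_section _ (borel_sphere R hd) _ F mF u).
    by move=> v Uv; exact: UF.
rewrite /b !inord_val -lerBlDl.
have pp : 0 < p j * p i by rewrite mulr_gt0.
have -> : a i / p i * (a j / p j) * \int[m i]_u \int[m j]_v F u v -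
    a i * a j * F (x i) (x j) =
    a i * a j * ((\int[m i]_u \int[m j]_v F u v - F (x i) (x j) * p j * p i) /
                (p j * p i)).
  by field; rewrite !gt_eqF.
rewrite (le_trans (ler_norm _))// normrM mulrC ler_wpM2r//.
by rewrite normrM normfV (gtr0_norm pp) ler_pdivrMr// mulrA.
Qed.

End support.

(** * The kernel on the sphere *)

Section inner_product.
Context (R : realType) (d : nat).
Implicit Types (x y z : 'rV[R]_d) (a : R).

Lemma dotpC x y : dotp x y = dotp y x.
Proof. by apply: eq_bigr => i _; rewrite mulrC. Qed.

Lemma dotpBr x y z : dotp x (y - z) = dotp x y - dotp x z.
Proof.
by rewrite /dotp -sumrB; apply: eq_bigr => i _; rewrite !mxE mulrBr.
Qed.

Lemma dotpBl x y z : dotp (x - y) z = dotp x z - dotp y z.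
Proof. by rewrite dotpC dotpBr !(dotpC z). Qed.

Lemma dotpZr a x y : dotp x (a *: y) = a * dotp x y.
Proof.
by rewrite /dotp mulr_sumr; apply: eq_bigr => i _; rewrite !mxE mulrCA.
Qed.

Lemma dotpZl a x y : dotp (a *: x) y = a * dotp x y.
Proof. by rewrite dotpC dotpZr dotpC. Qed.

Lemma dotpNl x y : dotp (- x) y = - dotp x y.
Proof. by rewrite -scaleN1r dotpZl mulN1r. Qed.

Lemma dotp_ge0 x : 0 <= dotp x x.
Proof. by apply: sumr_ge0 => i _; rewrite -expr2 sqr_ge0. Qed.

Lemma dotp_eq0 x : dotp x x = 0 -> x = 0.
Proof.
move=> /eqP; rewrite psumr_eq0 => [/allP x0|i _]; last by rewrite -expr2 sqr_ge0.
apply/rowP => i; rewrite mxE; apply/eqP.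
by have := x0 i (mem_index_enum _); rewrite mulf_eq0 orbb.
Qed.

Lemma enorm_ge0 x : 0 <= enorm x.
Proof. exact: sqrtr_ge0. Qed.

Lemma sqr_enorm x : enorm x ^+ 2 = dotp x x.
Proof. by rewrite sqr_sqrtr// dotp_ge0. Qed.

Lemma unit_sphereP x : unit_sphere x <-> dotp x x = 1.
Proof.
rewrite -sqr_enorm; split=> [->|]; first by rewrite expr1n.
by move=> x1; apply/eqP; rewrite -sqrp_eq1 ?enorm_ge0// x1.
Qed.

(** Cauchy-Schwarz for a unit vector [z]: the component of [v] orthogonal to [z] has nonnegative
    square norm. *)
Lemma normr_dotp_le (z v : 'rV[R]_d) : dotp z z = 1 -> `|dotp z v| <= enorm v.
Proof.
move=> z1; rewrite -(@ler_pXn2r _ 2) ?nnegrE ?enorm_ge0// real_normK ?num_real//.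
rewrite sqr_enorm -subr_ge0.
have := dotp_ge0 (v - dotp z v *: z).
rewrite dotpBr !dotpBl !dotpZr !dotpZl z1 (dotpC v z); lra.
Qed.

Lemma continuous_dotp (T : topologicalType) (f g : T -> 'rV[R]_d) :
  continuous f -> continuous g -> continuous (fun t => dotp (f t) (g t)).
Proof.
move=> cf cg; apply: (continuous_big (op := +%R)) => [|i _ t].
  exact: add_continuous.
apply: cvgM.
- apply: (@continuous_comp _ _ _ f (fun x => x ord0 i)); first exact: cf.
  exact: coord_continuous.
- apply: (@continuous_comp _ _ _ g (fun x => x ord0 i)); first exact: cg.
  exact: coord_continuous.
Qed.

Lemma unit_sphere_compact : compact (@unit_sphere R d).
Proof.
apply: bounded_closed_compact.
  exists 1; split; first exact: num_real.
  move=> M M1 x /unit_sphereP x1 /=; rewrite (le_trans _ (ltW M1))//.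
  suff : mx_norm x <= 1 by [].
  (* A nonzero max norm is attained at some coordinate, whose square is at most [dotp x x]. *)
  have [->//|/mx_norm_neq0[[i j] /= ->]] := eqVneq (mx_norm x) 0.
  rewrite (ord1 i) -(@ler_pXn2r _ 2) ?nnegrE// real_normK ?num_real// expr1n -x1.
  by rewrite /dotp (bigD1 j)//= expr2 lerDl sumr_ge0// => k _; rewrite -expr2 sqr_ge0.
have -> : @unit_sphere R d = (fun x => dotp x x) @^-1` [set 1].
  by apply/seteqP; split => x /unit_sphereP.
apply: closed_comp => [x _|]; last exact: closed_eq.
by apply: (@continuous_dotp _ id id) => y; exact: cvg_id.
Qed.

End inner_product.

(** * The one-variable profile *)

(** Multiplying the difference quotient out gives an estimate that also covers [u = t]. *)
Lemma is_derive_approx (R : realType) (f : R -> R) (t k e : R) :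
  is_derive t 1 f k -> 0 < e ->
  \forall u \near t, `|f u - f t - k * (u - t)| <= e * `|u - t|.
Proof.
move=> [df <-] e0; have /cvgrPdist_le /(_ e e0) := df.
rewrite -/('D_1 f t) => /nbhs_ballP[r r0 fr].
apply/nbhs_ballP; exists r => // u ur; have [->|ut] := eqVneq u t.
  by rewrite !subrr mulr0 subrr normr0 mulr0.
have ut0 : u - t != 0 by rewrite subr_eq0.
have utr : ball 0 r (u - t) by rewrite /ball /= sub0r normrN distrC.
have := fr _ utr ut0; rewrite /shift/= [_%:A]mulr1 subrK => h.
set D := 'D_1 f t in h *.
have -> : f u - f t - D * (u - t) = - (D - (u - t)^-1 * (f u - f t)) * (u - t).
  by field.
by rewrite normrM normrN ler_wpM2r.
Qed.

Section profile.
Context (R : realType) (p : R) (q : nat).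
Hypotheses (p0 : 0 < p) (pq : p < q%:R).

Definition profile (t : R) : R := t `^ p - p / q%:R * t ^+ q.

Let q0 : 0 < q%:R :> R. Proof. exact: lt_trans pq. Qed.

Let one_powR (x : R) : 1 `^ x = 1. Proof. by rewrite powR1. Qed.

Lemma q_neq0 : (q != 0)%N.
Proof. by have := q0; rewrite ltr0n lt0n. Qed.

Lemma expr_le_powR (t : R) : 0 <= t <= 1 -> t ^+ q <= t `^ p.
Proof.
move=> /andP[]; rewrite le_eqVlt => /predU1P[<- _|t0 t1].
  by rewrite expr0n (negbTE q_neq0) powR_ge0.
by rewrite -(powR_mulrn _ (ltW t0)) ger_powR ?t0//= ltW.
Qed.

Lemma profile_bounds (t : R) : 0 <= t <= 1 -> 0 <= profile t <= 1.
Proof.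
move=> t01; have /andP[t0 t1] := t01; have tqp := expr_le_powR t01.
have tq0 : 0 <= t ^+ q by rewrite exprn_ge0.
have pq0 : 0 <= p / q%:R by rewrite divr_ge0 ?ltW.
have pq1 : p / q%:R <= 1 by rewrite ler_pdivrMr// mul1r ltW.
have tp1 : t `^ p <= 1.
  by rewrite -[leRHS](one_powR p) ge0_ler_powR ?nnegrE ?(ltW p0).
have h1 : p / q%:R * t ^+ q <= 1 * t `^ p by rewrite ler_pM.
have h2 : 0 <= p / q%:R * t ^+ q by rewrite mulr_ge0.
by rewrite /profile; apply/andP; split; lra.
Qed.

Lemma is_derive_profile (t : R) : 0 < t ->
  is_derive t (1 : R) profile (p * (t `^ (p - 1) - t ^+ q.-1)).
Proof.
move=> t0.
have -> : profile = (fun u : R => u `^ p) - (p / q%:R) *: (@id R : R -> R) ^+ q.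
  by apply/funext => x; rewrite /profile !fctE.
have dp := is_derive1_powR p t0; apply: is_derive_eq.
by rewrite mulrBr [_%:A]mulr1 [_ *: _]mulrA divfK ?gt_eqF.
Qed.

(** After multiplication by [t] the claim is [t^q < t^p], which holds because [t^q = t^(q-p) t^p]
    and [t^(q-p) < 1]. *)
Lemma profile_slope_gt0 (t : R) : 0 < t < 1 -> 0 < p * (t `^ (p - 1) - t ^+ q.-1).
Proof.
move=> /andP[t0 t1]; rewrite mulr_gt0// subr_gt0 -(ltr_pM2l t0) -exprS.
rewrite prednK ?lt0n ?q_neq0// mulr_powRB1 ?(ltW t0)//.
rewrite -(powR_mulrn _ (ltW t0)) -(subrK p q%:R) powRD ?subrK ?(gt_eqF q0)//.
rewrite gtr_pMl ?powR_gt0// -[ltRHS](one_powR (q%:R - p)).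
by apply: gt0_ltr_powR; rewrite ?nnegrE ?subr_gt0// ltW.
Qed.

(** This cancellation is the effect of the coefficient [p / q] in the kernel; it makes
    [L x x - L x y] of smaller order than the squared distance. *)
Lemma profile_slope1 : p * (1 `^ (p - 1) - 1 ^+ q.-1) = 0 :> R.
Proof. by rewrite powR1 expr1n subrr mulr0. Qed.

Lemma continuous_powR_norm : continuous (fun t : R => `|t| `^ p).
Proof.
(* The origin is treated by hand, since for small [p] the power is not differentiable there;
   elsewhere differentiability suffices. *)
move=> t; have [->|t0] := eqVneq t 0.
  apply/cvgrPdist_lt => e e0.
  exists (e `^ p^-1) => [|u /=]; first by rewrite /= powR_gt0.
  rewrite sub0r normrN => ue.
  rewrite normr0 powR0 ?gt_eqF// sub0r normrN (ger0_norm (powR_ge0 _ _)).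
  have <- : (e `^ p^-1) `^ p = e.
    by rewrite -powRrM mulVf ?gt_eqF// powRr1// ltW.
  by apply: gt0_ltr_powR; rewrite ?nnegrE ?powR_ge0.
have nt0 : 0 < `|t| by rewrite normr_gt0.
apply: (@continuous_comp _ _ _ (fun t : R => `|t|) (fun t : R => t `^ p)).
  exact: norm_continuous.
apply: differentiable_continuous; apply/derivable1_diffP.
by have [] := is_derive1_powR p nt0.
Qed.

Lemma continuous_profile_norm : continuous (fun t : R => profile `|t|).
Proof.
move=> t; apply: cvgB; first exact: continuous_powR_norm.
apply: cvgM; first exact: cvg_cst.
apply: (@continuous_comp _ _ _ (fun t : R => `|t|) (fun t => t ^+ q)).
  exact: norm_continuous.
exact: exprn_continuous.
Qed.

End profile.

(** * Continuity, measurability and bounds of the kernel *)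

Lemma continuous_borel_measurable (T : ptopologicalType) (R : realType)
    (f : T -> R) : continuous f ->
  measurable_fun setT (f : g_sigma_algebraType (@open T) -> R).
Proof.
move=> /continuousP cf; apply: (measurability _ (RGenOpens.measurableE R)).
move=> _ [_ [a [b ->] <-]]; rewrite setTI; apply: sub_sigma_algebra.
exact/cf/interval_open.
Qed.

Section sphere_kernel.
Context (R : realType) (d : nat) (hd : (2 <= d)%N).
Implicit Types x y z : sphere R hd.

Lemma sdotxx x : sdot x x = 1.
Proof. by apply/unit_sphereP; case: x => x /= /set_mem. Qed.

Lemma sdotC x y : sdot x y = sdot y x.
Proof. exact: dotpC. Qed.

Lemma sqr_enorm_sub x y : enorm (\val x - \val y) ^+ 2 = 2 * (1 - sdot x y).
Proof.
rewrite sqr_enorm dotpBr !dotpBl -!/(sdot _ _) !sdotxx (sdotC y x); ring.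
Qed.

Lemma normr_sdot_le1 x y : `|sdot x y| <= 1.
Proof.
rewrite (le_trans (normr_dotp_le _ (sdotxx x)))//.
by rewrite /enorm -/(sdot y y) sdotxx sqrtr1.
Qed.

Lemma sdot_eq1 x y : sdot x y = 1 -> x = y.
Proof.
move=> xy; apply/val_inj/eqP; rewrite -subr_eq0; apply/eqP/dotp_eq0.
by rewrite -sqr_enorm sqr_enorm_sub xy subrr mulr0.
Qed.

Lemma continuous_val : continuous (fun x : sphere R hd => \val x : 'rV[R]_d).
Proof. exact: initial_continuous. Qed.

Lemma continuous_sdot (T : topologicalType) (f g : T -> sphere R hd) :
  continuous f -> continuous g -> continuous (fun t => sdot (f t) (g t)).
Proof.
move=> cf cg; apply: continuous_dotp => t.
  by apply: (@continuous_comp _ _ _ f); [exact: cf|exact: continuous_val].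
by apply: (@continuous_comp _ _ _ g); [exact: cg|exact: continuous_val].
Qed.

(** The product carries the product of the two Borel sigma-algebras, so measurability is built from
    the coordinates of each factor instead of from continuity on the product space. *)
Lemma measurable_sdot : measurable_fun setT
  (fun z : borel_sphere R hd * borel_sphere R hd => @sdot R d hd z.1 z.2).
Proof.
have mcoord (i : 'I_d) : measurable_fun setT
    (fun x : borel_sphere R hd => (\val x : 'rV[R]_d) ord0 i).
  apply: (@continuous_borel_measurable (sphere R hd)) => x.
  apply: (@continuous_comp _ _ _ (fun x : sphere R hd => \val x : 'rV[R]_d)
    (fun v => v ord0 i)); first exact: continuous_val.
  exact: coord_continuous.
apply: measurable_sum => i; apply: measurable_funM.
  exact: measurableT_comp (mcoord i) measurable_fst.
exact: measurableT_comp (mcoord i) measurable_snd.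
Qed.

Variables (p : R) (q : nat).

Lemma LE x y : L p q x y = profile p q `|sdot x y|.
Proof. by []. Qed.

Lemma measurable_L : measurable_fun setT
  (fun z : borel_sphere R hd * borel_sphere R hd => @L R d hd p q z.1 z.2).
Proof.
have mns : measurable_fun setT
    (fun z : borel_sphere R hd * borel_sphere R hd => `|@sdot R d hd z.1 z.2|).
  exact: measurableT_comp measurable_sdot.
apply: measurable_funB.
  exact: measurableT_comp (measurable_powR p) mns.
by apply: measurable_funM => //; apply: measurable_funX.
Qed.

Hypotheses (p0 : 0 < p) (pq : p < q%:R).

Lemma continuous_L :
  continuous (fun z : sphere R hd * sphere R hd => L p q z.1 z.2).
Proof.
move=> z; apply: (@continuous_comp _ _ _
  (fun z : sphere R hd * sphere R hd => sdot z.1 z.2)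
  (fun t => profile p q `|t|)).
  by apply: continuous_sdot => t; [exact: cvg_fst|exact: cvg_snd].
exact: continuous_profile_norm.
Qed.

Lemma L_bounds x y : 0 <= L p q x y <= 1.
Proof. by apply: profile_bounds => //; rewrite normr_ge0 normr_sdot_le1. Qed.

(** The difference is [-(p/q) |x.y|^q], whose absolute value is largest on the diagonal. *)
Lemma supnorm_LK :
  supnorm (fun x y : sphere R hd => L p q x y - K p x y) = (p / q%:R)%:E.
Proof.
have q0 : 0 < q%:R :> R by exact: lt_trans pq.
have pq0 : 0 <= p / q%:R by rewrite divr_ge0// ltW.
have LK x y : `|L p q x y - K p x y| = p / q%:R * `|sdot x y| ^+ q.
  rewrite /L /K addrAC subrr add0r normrN ger0_norm//.
  by rewrite mulr_ge0// exprn_ge0.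
apply/eqP; rewrite eq_le; apply/andP; split.
  apply: ub_ereal_sup => _ [[x y] _ <-]; rewrite lee_fin LK ler_piMr//.
  by rewrite exprn_ile1// normr_sdot_le1.
apply: ereal_sup_ubound; exists (point, point) => //=.
by rewrite LK sdotxx normr1 expr1n mulr1.
Qed.

End sphere_kernel.

(** * Limit points of the support *)

Section accumulation.
Context (R : realType) (d : nat) (hd : (2 <= d)%N).

Lemma infinite_sphere_limit_point (S : set (sphere R hd)) :
  infinite_set S -> limit_point S !=set0.
Proof.
move=> Sinf; pose cofin : set_system (sphere R hd) :=
  [set A | finite_set (S `\` A)].
have cofinP : ProperFilter cofin.
  apply: Build_ProperFilter_ex => [A /= SA|].
    have [//|A0] := pselect (A !=set0); exfalso; apply: Sinf.
    have A_0 : A = set0 by apply/seteqP; split=> // x Ax; apply: A0; exists x.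
    by move: SA; rewrite /cofin /= A_0 setD0.
  split; rewrite /cofin /=.
  - by rewrite setDT; exact: finite_set0.
  - by move=> A B SA SB; rewrite /cofin /= setDIr finite_setU.
  - by move=> A B AB; apply: sub_finite_set => x [Sx nBx]; split=> // /AB.
have cofinS : (\val @ cofin) (@unit_sphere R d).
  apply: (@sub_finite_set _ _ set0); last exact: finite_set0.
  by move=> x [_]; apply; exact/unit_sphereP/sdotxx.
have [v [/mem_set vS vcl]] := unit_sphere_compact _ cofinS.
exists (exist _ v vS) => U /=.
move=> [_ [/= [W oW <-] Wv] WU].
have cofinS' : cofin (S `\ (exist _ v vS)).
  rewrite /cofin /= setDD; apply: sub_finite_set (finite_set1 (exist _ v vS)).
  by move=> x [].
(* Removing [v] from [S] discards at most one point, so the rest still belongs to the filter and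
   meets every neighborhood of [v]. *)
have [|w [[y [Sy yv] <-] Wy]] :=
  vcl (\val @` (S `\ (exist _ v vS))) W _ (open_nbhs_nbhs (conj oW Wv)).
  by apply: filterS cofinS' => y ?; exists y.
by exists y; split => //; [exact/eqP|exact: WU].
Qed.

Lemma msupport_limit_point (mu : probability (borel_sphere R hd) R) x :
  limit_point (msupport mu) x -> msupport mu x.
Proof.
by move=> xS U oU Ux; have [y [_ yS Uy]] := xS U (open_nbhs_nbhs (conj oU Ux));
  exact: yS.
Qed.

End accumulation.

(** * Directions at a limit point of the support *)

Section finite_support.
Context (R : realType) (d : nat) (hd : (2 <= d)%N) (p : R) (q : nat).
Hypotheses (p0 : 0 < p) (pq : p < q%:R).
Variable mu : probability (borel_sphere R hd) R.
Hypothesis mu_min : minimizes_energy (L p q) mu.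

Local Notation S := (msupport mu).
Local Notation f := (profile p q).

Lemma L_diag (x : sphere R hd) : L p q x x = f 1.
Proof. by rewrite LE sdotxx normr1. Qed.

Lemma L_sym (x y : sphere R hd) : L p q x y = L p q y x.
Proof. by rewrite !LE sdotC. Qed.

(* With [D := f 1 - L p q], this is the square of the triangle inequality
   [sqrt (D x z) <= sqrt (D x y) + sqrt (D y z)], linearized with a weight. *)
Lemma three_points (x y z : sphere R hd) (t : R) : S x -> S y -> S z -> 0 < t ->
  L p q y z - L p q x z <=
  (1 + t) * (f 1 - L p q x y) + t^-1 * (f 1 - L p q y z).
Proof.
move=> Sx Sy Sz t0.
have XS i : S (tnth [tuple x; y; z] i).
  by rewrite (tnth_nth x); case: i => [[|[|[|]]]].
(* With these weights at [x], [y], [z], the quadratic form is [2 * t] times the difference of the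
   two sides. *)
have a0 : \sum_i tnth [tuple t; - (1 + t); 1] i = 0.
  by rewrite !big_ord_recl big_ord0 !(tnth_nth 0) /=; ring.
have := support_positive_semidefinite (@continuous_L R d hd p q p0)
  (@measurable_L R d hd p q) (L_bounds p0 pq) mu_min XS a0.
rewrite !big_ord_recl !big_ord0 !(tnth_nth x) !(tnth_nth 0) /=.
rewrite !L_diag (L_sym y x) (L_sym z x) (L_sym z y).
move: (L p q y z) (L p q x z) (L p q x y) (f 1) => byz bxz bxy c h.
rewrite -subr_ge0 -(pmulr_rge0 _ t0) -(pmulr_rge0 _ (ltr0Sn R 1)).
rewrite (le_trans h)// le_eqVlt; apply/orP; left; apply/eqP; field.
by rewrite gt_eqF.
Qed.

(** The unit vector from [x] towards [y]; for [y = x] it is the default value 0. *)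
Definition direction (x y : sphere R hd) : 'rV[R]_d :=
  (enorm (\val y - \val x))^-1 *: (\val y - \val x).

Lemma enorm_sub_gt0 (x y : sphere R hd) : y != x -> 0 < enorm (\val y - \val x).
Proof.
move=> yx; rewrite lt_neqAle enorm_ge0 andbT eq_sym; apply: contra_neq yx => xy0.
apply: sdot_eq1; have := sqr_enorm_sub y x.
by rewrite xy0 expr0n /= => /eqP; rewrite eq_sym mulf_eq0 pnatr_eq0/= subr_eq0 => /eqP.
Qed.

Lemma enorm_direction (x y : sphere R hd) : y != x -> enorm (direction x y) = 1.
Proof.
move=> /enorm_sub_gt0 s0; apply/unit_sphereP.
rewrite /direction dotpZl dotpZr -sqr_enorm; field.
by rewrite gt_eqF.
Qed.

Lemma dotp_direction (v : 'rV[R]_d) (x y : sphere R hd) :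
  dotp v (direction x y) =
  (dotp v (\val y) - dotp v (\val x)) / enorm (\val y - \val x).
Proof. by rewrite /direction dotpZr dotpBr mulrC. Qed.

Lemma cvg_sdot (z x : sphere R hd) : sdot z y @[y --> x] --> sdot z x.
Proof.
apply: (@continuous_sdot R d hd _ (cst z) id); first exact: cst_continuous.
by move=> y A.
Qed.

(** Near [x] the product [sdot z y] stays positive, so the absolute value disappears and the
    expansion of the profile applies. It serves both for [z] near [x] and for [z = x], where the
    slope is zero. *)
Lemma near_sdot_profile (x z : sphere R hd) (e : R) : 0 < sdot z x -> 0 < e ->
  \forall y \near x,
    `|L p q z y - L p q z x - p * (sdot z x `^ (p - 1) - sdot z x ^+ q.-1) *
      (sdot z y - sdot z x)| <= e * `|sdot z y - sdot z x|.
Proof.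
move=> zx0 e0.
have cz := @cvg_sdot z x.
have near_zx := is_derive_approx (is_derive_profile p0 pq zx0) e0.
have near_gt0 := cvgr_gt _ cz _ zx0.
near=> y; have zy0 : 0 < sdot z y by near: y; exact: near_gt0.
rewrite !LE (gtr0_norm zx0) (gtr0_norm zy0); near: y; exact: cz near_zx.
Unshelve. all: by end_near. Qed.

(* The three-point inequality is used with [t = T / |y - x|]: the first term on
   its right is [o(|y - x|)] because the slope of the profile vanishes at [1],
   and the second one is at most [|y - x| / T]. *)
Lemma near_dotp_direction_le (x z : sphere R hd) (e : R) : S x -> S z ->
  0 < sdot z x < 1 -> 0 < e ->
  \forall y \near x, S y -> y != x -> dotp (\val z) (direction x y) <= e.
Proof.
move=> Sx Sz zx01 e0; have /andP[zx0 zx1] := zx01.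
set k := p * (sdot z x `^ (p - 1) - sdot z x ^+ q.-1).
have k0 : 0 < k by exact: profile_slope_gt0.
(* With [s = |y - x|], the remainder at [z] is at most [e1 * s], and the two terms of the
   three-point inequality are at most [e1 * s / 2] and [s / T = e1 * s]. Their sum is below
   [k * e * s]. *)
pose e1 := k * e / 4; have e10 : 0 < e1 by rewrite divr_gt0// mulr_gt0.
pose T := e1^-1; have T0 : 0 < T by rewrite invr_gt0.
pose e2 := e1 / (1 + T); have e20 : 0 < e2 by rewrite divr_gt0// addr_gt0.
have near_z := near_sdot_profile zx0 e10.
(* This threshold forces [|y - x| <= 1], by which [s + T] is later bounded by [1 + T]. *)
have near_half : \forall y \near x, 2^-1 < sdot x y.
  by apply: (cvgr_gt _ (@cvg_sdot x x)); rewrite sdotxx invf_lt1// ltr1n.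
near=> y => Sy yx; have s0 := enorm_sub_gt0 yx.
have zy : `|L p q z y - L p q z x - k * (sdot z y - sdot z x)| <=
    e1 * `|sdot z y - sdot z x| by near: y; exact: near_z.
have xy : `|L p q x y - L p q x x - p * (sdot x x `^ (p - 1) - sdot x x ^+ q.-1) *
    (sdot x y - sdot x x)| <= e2 * `|sdot x y - sdot x x|.
  by near: y; apply: near_sdot_profile => //; rewrite sdotxx.
have xy_half : 2^-1 < sdot x y by near: y; exact: near_half.
move: zy xy; rewrite sdotxx profile_slope1 mul0r subr0 L_diag dotp_direction.
rewrite -!/(sdot _ _) ler_pdivrMr//.
have xy1 := le_trans (ler_norm _) (normr_sdot_le1 x y).
have := sqr_enorm_sub y x; rewrite (sdotC y x).
have := normr_dotp_le (\val y - \val x) (sdotxx z).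
rewrite dotpBr -!/(sdot _ _).
have := three_points Sx Sy Sz (divr_gt0 T0 s0).
rewrite invf_div (L_sym y z) (L_sym x z).
have := L_bounds p0 pq z y.
have := profile_bounds p0 pq (t := 1); rewrite ler01 lexx => /(_ isT).
(* Only real arithmetic remains: [s] is the distance, [a], [b], [c] are the kernel at [(z, y)],
   [(z, x)], [(x, y)], [v] is [sdot x y], and [w] is the increment of the product with [z]. *)
move: (enorm _) s0 (f 1) (L p q z y) (L p q z x) (L p q x y) (sdot x y) xy_half xy1
  (sdot z y - sdot z x).
clear -k0 e0 e10 T0 e20 => s s0 f1 a b c v v_half v1 w /andP[_ f11] /andP[a0 _].
move=> abc ws sv abw; rewrite (@ler0_norm _ (v - 1)) ?subr_le0// opprB => cf1.
have vs : 1 - v = s ^+ 2 / 2 by rewrite sv mulrC mulKf.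
have s1 : s <= 1.
  rewrite -(@ler_pXn2r _ 2) ?nnegrE ?(ltW s0)// expr1n sv; lra.
have fc : (1 + T / s) * (f1 - c) <= e1 * s / 2.
  have fc2 : f1 - c <= e2 * (s ^+ 2 / 2).
    by rewrite -vs (le_trans _ cf1)// distrC ler_norm.
  have Ts0 : 0 <= 1 + T / s by rewrite addr_ge0// divr_ge0// ltW.
  rewrite (le_trans (ler_wpM2l Ts0 fc2))//.
  have -> : (1 + T / s) * (e2 * (s ^+ 2 / 2)) = e2 * (s + T) * (s / 2).
    by field; rewrite gt_eqF.
  rewrite -[leRHS]mulrA ler_wpM2r ?divr_ge0 ?(ltW s0)//.
  by rewrite /e2 mulrAC ler_pdivrMr ?addr_gt0// ler_wpM2l ?(ltW e10)// lerD2r.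
have fa : s / T * (f1 - a) <= s * e1.
  have se1 := mulr_ge0 (ltW s0) (ltW e10).
  rewrite /T invrK -[leRHS]mulr1 (ler_wpM2l se1)//; lra.
have kw : k * w - e1 * s <= a - b.
  have := ler_wpM2l (ltW e10) ws.
  move: abw; rewrite ler_norml => /andP[]; lra.
have kwe : k * w <= k * (e * s).
  have e1s : e1 * s = k * (e * s) / 4 by rewrite /e1; field.
  have : 0 <= e1 * s by rewrite mulr_ge0// ltW.
  move: fc fa kw abc; rewrite e1s (mulrC s e1) e1s; lra.
by rewrite ler_pM2l in kwe.
Unshelve. all: by end_near. Qed.

(** The closed half-space of [w] with [dotp v w <= e] contains the directions to all nearby support
    points, hence also their cluster point; then [e] tends to 0. *)
Lemma cluster_dotp_le (x : sphere R hd) (u v : 'rV[R]_d) :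
  cluster (direction x @ within (S `\ x) (nbhs x)) u ->
  (forall e, 0 < e ->
    \forall y \near x, S y -> y != x -> dotp v (direction x y) <= e) ->
  dotp v u <= 0.
Proof.
move=> xu ve; apply/ler_addgt0Pr => e e0; rewrite add0r.
have : closed [set w | dotp v w <= e].
  apply: (@closed_comp _ _ (dotp v) [set r | r <= e]) => [w _|].
    by apply: (@continuous_dotp _ _ _ (cst v) id); [exact: cst_continuous|move=> ? ?].
  exact: closed_le.
apply; move: xu; rewrite clusterE; apply; rewrite /= /within /=.
apply: filterS (ve e e0) => y ye [Sy yx]; apply: ye => //.
exact/eqP.
Qed.

Lemma limit_point_msupport_eq0 : limit_point S = set0.
Proof.
apply/seteqP; split => // x xS.
have Sx := msupport_limit_point xS.
have near_dist (e : R) : 0 < e -> \forall y \near x, enorm (\val y - \val x) <= e.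
  move=> e0; have e20 : 1 - e ^+ 2 / 2 < sdot x x.
    by rewrite sdotxx ltrBlDr ltrDl divr_gt0// exprn_gt0.
  have near_x := cvgr_gt _ (@cvg_sdot x x) _ e20.
  near=> y; have xy : 1 - e ^+ 2 / 2 < sdot x y by near: y; exact: near_x.
  rewrite -(@ler_pXn2r _ 2) ?nnegrE ?enorm_ge0 ?(ltW e0)//.
  by rewrite sqr_enorm_sub sdotC; lra.
have FP : ProperFilter (within (S `\ x) (nbhs x)).
  apply: within_nbhs_proper => U /xS[y [/eqP yx Sy Uy]].
  by exists y.
have Fsphere : (direction x @ within (S `\ x) (nbhs x)) (@unit_sphere R d).
  rewrite /= /within /=; apply: nearW => y [_ /eqP yx].
  exact: enorm_direction.
have [u [/unit_sphereP u1 xu]] := unit_sphere_compact _ Fsphere.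
(* The product of [- x] with the direction to [y] is [|y - x| / 2], which tends to 0. *)
have xu0 : 0 <= dotp (\val x) u.
  rewrite -oppr_le0 -dotpNl; apply: (cluster_dotp_le xu) => e e0.
  have near_e := near_dist (2 * e) (mulr_gt0 (ltr0Sn R 1) e0).
  near=> y => Sy yx; have s0 := enorm_sub_gt0 yx.
  have se : enorm (\val y - \val x) <= 2 * e by near: y; exact: near_e.
  have := sqr_enorm_sub y x; rewrite sdotC => ss.
  rewrite dotp_direction !dotpNl -!/(sdot _ _) sdotxx ler_pdivrMr//.
  have := ler_wpM2r (ltW s0) se; move: ss; rewrite expr2; lra.
(* Here [z] is fixed while the directions tend to [u]; below, [z] itself becomes the moving point
   [y]. *)
have u_le0 z : S z -> 0 < sdot z x < 1 -> dotp u (\val z) <= 0.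
  move=> Sz zx; rewrite dotpC; apply: (cluster_dotp_le xu) => e.
  exact: near_dotp_direction_le.
(* Since [dotp u y <= 0 <= dotp u x], the product of [u] with each direction to a nearby support
   point is nonpositive, and this passes to the cluster point [u]. *)
suff : dotp u u <= 0 by rewrite u1 leNgt ltr01.
apply: (cluster_dotp_le xu) => e e0.
have near_gt0 : \forall y \near x, 0 < sdot x y.
  by apply: (cvgr_gt _ (@cvg_sdot x x)); rewrite sdotxx.
near=> y => Sy yx; have s0 := enorm_sub_gt0 yx.
rewrite (le_trans _ (ltW e0))// dotp_direction ler_pdivrMr// mul0r subr_le0.
rewrite (le_trans (u_le0 y Sy _)) ?(dotpC u (\val x))//.
have yx0 : 0 < sdot y x by rewrite sdotC; near: y; exact: near_gt0.
rewrite yx0 lt_neqAle (le_trans (ler_norm _) (normr_sdot_le1 y x)) andbT.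
by apply: contra_neq yx; exact: sdot_eq1.
Unshelve. all: by end_near. Qed.

End finite_support.

Theorem theorem1p4 (R : realType) (d : nat) (hd : (2 <= d)%N)
    (p : R) (hp : 0 < p) (q : nat) (hq : ~~ odd q) (hpq : p < q%:R) :
  [/\ continuous
        (fun z : sphere R hd * sphere R hd => L p q z.1 z.2),
      forall mu : probability (borel_sphere R hd) R,
        minimizes_energy (L p q) mu -> finite_set (msupport mu)
    & supnorm (fun x y : sphere R hd => L p q x y - K p x y) = (p / q%:R)%:E].
Proof.
split; [exact: continuous_L| |exact: supnorm_LK].
move=> mu mu_min; apply: contrapT => /infinite_sphere_limit_point.
by rewrite (limit_point_msupport_eq0 hp hpq mu_min) => -[].
Qed.
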